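(* For every $1\leq k\leq 4$, every $k$-icube in $\mathbb{Z}[i]^4$ can be extended to a $4$-icube (of the same norm).
   Context: For $1\leq k\leq n$, a matrix $(v_1|\dotsc|v_k)\in\mathbb{Z}[i]^{n\times k}$ is a $k$-icube in $\mathbb{Z}[i]^n$ of norm $\lambda>0$ if $v_i^*v_j=\lambda$ for $i=j$ and $v_i^*v_j=0$ for $i\neq j$, where $v^*=\overline{v}^T$. An $\ell$-icube $A$ can be extended to a $k$-icube ($\ell<k$) if some $\ell$ columns of some $k$-icube form $A$. *)

(* Defs.v *)
From HB Require Import structures.
From mathcomp Require Import all_boot all_order all_algebra all_field.
Set Implicit Arguments. Unset Strict Implicit. Unset Printing Implicit Defensive.
Import Order.TTheory GRing.Theory Num.Theory.
Local Open Scope ring_scope.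

(* Gaussian integers Z[i], viewed inside the algebraic complex numbers algC. *)
Definition gaussInt (x : algC) : bool :=
  ('Re x \is a Num.int) && ('Im x \is a Num.int).

(* conjugate transpose v^* = conj(v)^T *)
Definition ctrmx m n (A : 'M[algC]_(m, n)) : 'M[algC]_(n, m) := (map_mx (fun x => x^*) A)^T.

(* A = (v_1|...|v_k) in Z[i]^{n x k} is a k-icube of norm lam > 0:
   v_i^* v_j = lam if i = j and 0 otherwise. *)
Definition icube n k (A : 'M[algC]_(n, k)) (lam : algC) : Prop :=
  0 < lam /\
  (forall i j, gaussInt (A i j)) /\
  (forall a b : 'I_k, (ctrmx A *m A) a b = if a == b then lam else 0).

(* The l-icube A (of norm lam) can be extended to a k-icube: some l columns
   of some k-icube B (of norm lam) form A. *)
Definition icube_extends n l (A : 'M[algC]_(n, l)) (k : nat) (lam : algC) : Prop :=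
  exists (B : 'M[algC]_(n, k)) (f : 'I_l -> 'I_k),
    icube B lam /\ injective f /\ (forall j : 'I_l, col (f j) B = col j A).

(* Main.v *)
Require Import Defs.
From HB Require Import structures.
From mathcomp Require Import all_boot all_order all_algebra all_field.
From mathcomp Require Import perm zify ring.
Import Order.TTheory GRing.Theory Num.Theory.
Local Open Scope ring_scope.

(** Write [P = lam I - A A'], with [A'] the conjugate transpose; completing the
    icube [A] to a square one means factoring [P = B B'] over the Gaussian
    integers.  A single column [(a, b, c, d)] is orthogonal to the conjugate of
    [(-b, a, -d, c)], so it suffices to treat two and three columns.

    For two columns, put [H_ij = P_ij + delta_ij j], where [delta_ij] is the
    conjugate of the 2x2 minor of [A] on the complementary rows.  These
    quaternions satisfy [H_i0 H_0j = P_00 H_ij], so [P_00] divides all products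
    [conj(H_0i) H_0j].  For integral quaternions this forces the [H_0j] to have a
    common left divisor [x] of norm [P_00]: one prime at a time, by Euler's
    descent for the four-square theorem, which preserves the divisibility
    conditions.  If [H_0j = x y_j], the conjugates of the [y_j], read as pairs of
    Gaussian integers, are the rows of [B].

    For three columns, complete the first two by [b1, b2]; then
    [w = - conj(t) b1 + conj(s) b2] with [s = b1' v3] and [t = b2' v3] satisfies
    [w w' = lam^2 P].  The descent stays inside the Gaussian integers when it
    starts there, and yields a common divisor of norm [lam^2] of the entries
    of [w]. *)

(** * Integral quaternions and divisibility by integers *)

Record quat := Quat { q0 : int; q1 : int; q2 : int; q3 : int }.

Definition qmul (x y : quat) : quat :=
  Quat (q0 x * q0 y - q1 x * q1 y - q2 x * q2 y - q3 x * q3 y)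
       (q0 x * q1 y + q1 x * q0 y + q2 x * q3 y - q3 x * q2 y)
       (q0 x * q2 y - q1 x * q3 y + q2 x * q0 y + q3 x * q1 y)
       (q0 x * q3 y + q1 x * q2 y - q2 x * q1 y + q3 x * q0 y).

Definition qconj (x : quat) : quat := Quat (q0 x) (- q1 x) (- q2 x) (- q3 x).

Definition qscale (k : int) (x : quat) : quat :=
  Quat (k * q0 x) (k * q1 x) (k * q2 x) (k * q3 x).

Definition qnorm (x : quat) : int :=
  q0 x ^+ 2 + q1 x ^+ 2 + q2 x ^+ 2 + q3 x ^+ 2.

Definition qdvd (d : int) (x : quat) : bool :=
  [&& (d %| q0 x)%Z, (d %| q1 x)%Z, (d %| q2 x)%Z & (d %| q3 x)%Z].

Definition qgauss (x : quat) : bool := (q2 x == 0) && (q3 x == 0).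

Lemma quat_eq (x y : quat) :
  q0 x = q0 y -> q1 x = q1 y -> q2 x = q2 y -> q3 x = q3 y -> x = y.
Proof. by case: x y => [? ? ? ?] [? ? ? ?] /= -> -> -> ->. Qed.

Lemma qmulA (x y z : quat) : qmul x (qmul y z) = qmul (qmul x y) z.
Proof. by apply: quat_eq => /=; ring. Qed.

Lemma qconjM (x y : quat) : qconj (qmul x y) = qmul (qconj y) (qconj x).
Proof. by apply: quat_eq => /=; ring. Qed.

Lemma qconj_mul (x y : quat) : qmul (qconj x) (qmul x y) = qscale (qnorm x) y.
Proof. by apply: quat_eq; rewrite /qnorm /=; ring. Qed.

Lemma qmul_conj (x y : quat) : qmul x (qmul (qconj x) y) = qscale (qnorm x) y.
Proof. by apply: quat_eq; rewrite /qnorm /=; ring. Qed.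

Lemma qscaleAl (k : int) (x y : quat) : qmul (qscale k x) y = qscale k (qmul x y).
Proof. by apply: quat_eq => /=; ring. Qed.

Lemma qscaleAr (k : int) (x y : quat) : qmul x (qscale k y) = qscale k (qmul x y).
Proof. by apply: quat_eq => /=; ring. Qed.

Lemma qscaleA (k l : int) (x : quat) : qscale k (qscale l x) = qscale (k * l) x.
Proof. by apply: quat_eq => /=; ring. Qed.

Lemma qconjZ (k : int) (x : quat) : qconj (qscale k x) = qscale k (qconj x).
Proof. by apply: quat_eq => /=; ring. Qed.

Lemma qnormM (x y : quat) : qnorm (qmul x y) = qnorm x * qnorm y.
Proof. by rewrite /qnorm /=; ring. Qed.

Lemma qnormZ (k : int) (x : quat) : qnorm (qscale k x) = k ^+ 2 * qnorm x.
Proof. by rewrite /qnorm /=; ring. Qed.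

Lemma qnorm_conj (x : quat) : qnorm (qconj x) = qnorm x.
Proof. by rewrite /qnorm /=; ring. Qed.

Lemma qscaleI (k : int) (x y : quat) : k != 0 -> qscale k x = qscale k y -> x = y.
Proof.
by move=> k0 [/(mulfI k0) e0 /(mulfI k0) e1 /(mulfI k0) e2 /(mulfI k0) e3]; apply: quat_eq.
Qed.

Lemma qdvdP (d : int) (x : quat) : reflect (exists y, x = qscale d y) (qdvd d x).
Proof.
apply: (iffP and4P) => [[/dvdzP[a ea] /dvdzP[b eb] /dvdzP[c ec] /dvdzP[e ee]]|[y ->]].
  by exists (Quat a b c e); apply: quat_eq => /=; rewrite mulrC.
by split; apply: dvdz_mulr.
Qed.

Lemma qdvd_mull (d : int) (x y : quat) : qdvd d y -> qdvd d (qmul x y).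
Proof. by move=> /qdvdP[z ->]; apply/qdvdP; exists (qmul x z); rewrite qscaleAr. Qed.

Lemma qdvd_scale_coprime (d k : int) (x : quat) :
  coprimez d k -> qdvd d (qscale k x) = qdvd d x.
Proof. by move=> cdk; rewrite /qdvd /= !(Gauss_dvdzr _ cdk). Qed.

(** Conjugating [k x' = x s] gives [k conj(x') q = conj(s) conj(x) q], and [k] is invertible modulo
    [p]. This is how a descent step keeps the divisibility conditions. *)
Lemma qdvd_descent (p : nat) (k : int) (x s x' q : quat) :
  coprimez p k -> qscale k x' = qmul x s ->
  qdvd p (qmul (qconj x) q) -> qdvd p (qmul (qconj x') q).
Proof.
move=> cpk e h; rewrite -(qdvd_scale_coprime _ _ _ cpk) -qscaleAl -qconjZ e qconjM -qmulA.
exact: qdvd_mull.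
Qed.

(** * Centred residues and Euler's descent *)

Lemma coprimez_small (p m : nat) : prime p -> (0 < m < p)%N -> coprimez p m.
Proof. by move=> pp /andP[m0 mp]; rewrite coprimezE /= prime_coprime // gtnNdvd. Qed.

Lemma odd_residue (m : nat) (a : int) : odd m ->
  exists r z : int, a = r + m%:Z * z /\ `|2 * r| < m%:Z.
Proof.
move=> om; have m0 : m%:Z != 0 by lia.
have := divz_eq a m; have := modz_ge0 a m0; have := @ltz_pmod a m.
move: (a %/ m)%Z (a %% m)%Z => z r rm r0 ->.
have {}rm : r < m by apply: rm; lia.
case: (boolP (2 * r < m%:Z)) => h.
  by exists r, z; split; [ring | lia].
by exists (r - m%:Z), (z + 1); split; [ring | lia].
Qed.

(** In this form [lia] can read parity conditions off a sum of squares. *)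
Lemma even_sqr (a : int) : exists k : int, a ^+ 2 = a + 2 * k.
Proof.
have [z [->|->]] : exists z : int, a = 2 * z \/ a = 2 * z + 1.
  by exists (a %/ 2)%Z; lia.
  by exists (2 * z ^+ 2 - z); ring.
by exists (2 * z ^+ 2 + z); ring.
Qed.

(** The multiplier [s] is [1 + i], [1 + j] or [1 + k]: the coordinates of [x] have an even sum, so
    they split into two pairs of equal parity, and the pairing selects [s]. A Gaussian [x] falls
    under [1 + i], so [x'] is Gaussian too. *)
Lemma qhalf (x : quat) (n : int) : qnorm x = 2 * n ->
  exists s x', qscale 2 x' = qmul x s /\ qnorm x' = n /\ (qgauss x -> qgauss x').
Proof.
move=> nx.
have half s : qnorm s = 2 -> (qgauss x -> qgauss s) -> qdvd 2 (qmul x s) ->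
    exists s x', qscale 2 x' = qmul x s /\ qnorm x' = n /\ (qgauss x -> qgauss x').
  move=> ns gs /qdvdP[x' ex']; exists s, x'; split=> //; split.
    have := congr1 qnorm ex'; rewrite qnormM qnormZ nx ns; lia.
  move=> gx; move: gx (gs gx) => /andP[/eqP x2 /eqP x3] /andP[/eqP s2 /eqP s3].
  case: ex' => _ _; rewrite s2 s3 x2 x3 => e2 e3.
  by apply/andP; split; apply/eqP; lia.
case: x nx half => a b c d; rewrite /qnorm /qgauss /= => nx half.
have [[ka ea] [kb eb]] := (even_sqr a, even_sqr b).
have [[kc ec] [kd ed]] := (even_sqr c, even_sqr d).
have par : a + b + c + d = 2 * (n - ka - kb - kc - kd) by lia.
move: (n - _ - _ - _ - _) par => k par {nx ea eb ec ed ka kb kc kd}.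
case: (boolP (2 %| a - b)%Z) => ab.
  by apply: (half (Quat 1 1 0 0)) => //; rewrite /qdvd /=; apply/and4P; split; lia.
have cd : (c == 0) && (d == 0) -> False by move=> h; apply: (negP ab); lia.
case: (boolP (2 %| a - c)%Z) => ac.
  apply: (half (Quat 1 0 1 0)) => //.
  by rewrite /qdvd /=; apply/and4P; split; lia.
apply: (half (Quat 1 0 0 1)) => //.
by rewrite /qdvd /=; apply/and4P; split; lia.
Qed.

(** For odd [m] the centred residues are strictly below [m / 2], so four of them give a norm below
    [m ^ 2]. A zero coordinate has residue zero. *)
Lemma qresidue (m : nat) (x : quat) : odd m ->
  exists y z, x = Quat (q0 y + m%:Z * q0 z) (q1 y + m%:Z * q1 z)
                       (q2 y + m%:Z * q2 z) (q3 y + m%:Z * q3 z) /\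
    qnorm y < m%:Z ^+ 2 /\ (qgauss x -> qgauss y).
Proof.
move=> om; case: x => a b c d.
have [a' [za [ea ha]]] := odd_residue m a om.
have [b' [zb [eb hb]]] := odd_residue m b om.
have [c' [zc [ec hc]]] := odd_residue m c om.
have [d' [zd [ed hd]]] := odd_residue m d om.
exists (Quat a' b' c' d'), (Quat za zb zc zd); split; first by apply: quat_eq.
split.
  have sq (r : int) : `|2 * r| < m%:Z -> 4 * r ^+ 2 < m%:Z ^+ 2.
    by move=> h; nia.
  by move: (sq _ ha) (sq _ hb) (sq _ hc) (sq _ hd); rewrite /qnorm /=; lia.
have small (r z : int) : `|2 * r| < m%:Z -> r + m%:Z * z = 0 -> r = 0.
  move=> h e; have [z0|z0] : z = 0 \/ 1 <= `|z| by lia.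
    by move: e; rewrite z0; lia.
  by nia.
move=> /andP[/= /eqP c0 /eqP d0]; apply/andP => /=.
have -> : c' = 0 by apply: (small _ zc hc); rewrite -ec.
by have -> : d' = 0 by apply: (small _ zd hd); rewrite -ed.
Qed.

(** Induction on [m]. An even [m] is halved; for odd [m], with [y] the centred residue of [x], the
    quotient [x conj(y) / m] has norm [m' p] with [0 < m' < m]. *)
Lemma qdescent (p : nat) : prime p -> odd p ->
  forall (m : nat) (x : quat), (0 < m < p)%N -> qnorm x = m%:Z * p%:Z ->
  exists x', qnorm x' = p /\ (qgauss x -> qgauss x') /\
    forall q, qdvd p (qmul (qconj x) q) -> qdvd p (qmul (qconj x') q).
Proof.
move=> pp op m; elim/ltn_ind: m => m IH x hm nx.
have [m1|m1] := eqVneq m 1%N; first by exists x; rewrite nx m1 mul1r.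
have step (k m' : nat) (s x1 : quat) : (0 < k < p)%N -> (0 < m' < m)%N ->
    qscale k x1 = qmul x s -> qnorm x1 = m'%:Z * p%:Z -> (qgauss x -> qgauss x1) ->
    exists x', qnorm x' = p /\ (qgauss x -> qgauss x') /\
      forall q, qdvd p (qmul (qconj x) q) -> qdvd p (qmul (qconj x') q).
  move=> hk hm' e nx1 gx1.
  have [||x' [nx' [gx' dx']]] := IH m' _ x1 _ nx1; [lia|lia|].
  exists x'; split=> //; split=> [gx|q dq]; first by apply: gx'; apply: gx1.
  by apply: dx'; apply: (qdvd_descent _ k _ s) e dq; apply: coprimez_small.
case: (boolP (odd m)) => om; last first.
  have [|s [x1 [e [nx1 gx1]]]] := qhalf x (m./2%:Z * p%:Z); first by rewrite nx; nia.
  by apply: (step 2%N m./2 s x1) => //; lia.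
have [y [z [ex [ny gy]]]] := qresidue m x om.
have m0 : m%:Z != 0 by lia.
(* This is [p - x conj(z)], since [x conj(y) = x (conj(x) - m conj(z))] and [x] has norm [m p]. *)
pose x1 := Quat (p%:Z - q0 (qmul x (qconj z))) (- q1 (qmul x (qconj z)))
                (- q2 (qmul x (qconj z))) (- q3 (qmul x (qconj z))).
have ex1 : qscale m x1 = qmul x (qconj y).
  have : m%:Z * p%:Z = q0 x ^+ 2 + q1 x ^+ 2 + q2 x ^+ 2 + q3 x ^+ 2 by rewrite -nx.
  rewrite /x1; move: nx => _; rewrite ex /=.
  move: (m%:Z) (p%:Z) => M P e.
  by apply: quat_eq => /=; rewrite ?mulrBr ?e; ring.
clearbody x1.
have [m' nym] : exists m' : int, qnorm y = m%:Z * m'.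
  exists (p%:Z - 2 * (q0 y * q0 z + q1 y * q1 z + q2 y * q2 z + q3 y * q3 z) - m%:Z * qnorm z).
  by rewrite mulrBr mulrBr -nx ex /qnorm /=; ring.
have nx1 : qnorm x1 = m' * p%:Z.
  apply: (mulfI (expf_neq0 2 m0)); rewrite -qnormZ ex1 qnormM qnorm_conj nx nym; ring.
have m'ge : 0 <= m'.
  have : 0 <= qnorm y by rewrite /qnorm; nia.
  by rewrite nym; nia.
(* If [m' = 0], then [y = 0] and [x = m z], so [m] divides [p], impossible for [1 < m < p]. *)
have m'0 : m' != 0.
  apply/eqP => m'0.
  have y0 : qnorm y = 0 by rewrite nym m'0 mulr0.
  have yi : q0 y = 0 /\ q1 y = 0 /\ q2 y = 0 /\ q3 y = 0.
    by move: y0; rewrite /qnorm; nia.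
  have : m%:Z * p%:Z = m%:Z * (m%:Z * qnorm z).
    by rewrite -nx ex; case: yi => [-> [-> [-> ->]]]; rewrite /qnorm /=; ring.
  move=> /(mulfI m0) e.
  have : (m %| p)%N by have := dvdz_mulr (qnorm z) (dvdzz m); rewrite -e.
  by move: pp => /primeP[_ h] /h; lia.
have m'm : m' < m%:Z by move: ny; rewrite nym; nia.
apply: (step m `|m'|%N (qconj y) x1) => //; first by lia.
- by rewrite nx1; congr (_ * _); lia.
move=> gx; move: gx (gy gx) => /andP[/eqP x2 /eqP x3] /andP[/eqP s2 /eqP s3].
case: ex1 => _ _; rewrite s2 s3 x2 x3 => e2 e3.
by apply/andP; split; apply/eqP; apply: (mulfI m0); rewrite mulr0 ?e2 ?e3; ring.
Qed.

(** Reducing [x] modulo [p] keeps the conditions modulo [p] and makes the norm [m p] with [m < p],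
    where the descent applies; [m] is nonzero because [p] does not divide [x]. *)
Lemma qdvd_norm_prime (p : nat) (x : quat) : prime p -> odd p ->
  (p%:Z %| qnorm x)%Z -> ~~ qdvd p x ->
  exists x', qnorm x' = p /\ (qgauss x -> qgauss x') /\
    forall q, qdvd p (qmul (qconj x) q) -> qdvd p (qmul (qconj x') q).
Proof.
move=> pp op px npx; have p0 := prime_gt0 pp.
have [y [z [ex [ny gy]]]] := qresidue p x op.
have [m nym] : exists m : int, qnorm y = m * p%:Z.
  have /dvdzP[k ek] := px.
  exists (k - 2 * (q0 y * q0 z + q1 y * q1 z + q2 y * q2 z + q3 y * q3 z) - p%:Z * qnorm z).
  by rewrite mulrBl mulrBl -ek ex /qnorm /=; ring.
have m0 : 0 <= m.
  have : 0 <= qnorm y by rewrite /qnorm; nia.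
  by rewrite nym; nia.
have m1 : m != 0.
  apply: contra npx => /eqP m0'.
  have : q0 y = 0 /\ q1 y = 0 /\ q2 y = 0 /\ q3 y = 0.
    by move: nym; rewrite m0' mul0r /qnorm; nia.
  rewrite ex => -[-> [-> [-> ->]]]; apply/qdvdP; exists z.
  by apply: quat_eq => /=; rewrite add0r.
have mp : m < p%:Z by move: ny; rewrite nym; nia.
have [||x' [nx' [gx' dx']]] := qdescent p pp op `|m|%N y; [lia|rewrite nym; lia|].
exists x'; split=> //; split=> [gx|q dq]; first by apply: gx'; apply: gy.
apply: dx'; move: dq => /qdvdP[w ew].
apply/qdvdP; exists (Quat (q0 w - q0 (qmul (qconj z) q)) (q1 w - q1 (qmul (qconj z) q))
                          (q2 w - q2 (qmul (qconj z) q)) (q3 w - q3 (qmul (qconj z) q))).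
move: ew; rewrite ex => -[e0 e1 e2 e3].
by apply: quat_eq; rewrite /= mulrBr -?e0 -?e1 -?e2 -?e3; ring.
Qed.

(** * Left divisors of prime norm *)

(** Pigeonhole in ['F_p]: for [i] and [j] from 0 to [(p - 1) / 2], the values [i ^ 2] and
    [- 1 - j ^ 2] form two sets of [(p + 1) / 2] elements, which must meet. *)
Lemma sum_two_squares_neg1 (p : nat) : prime p -> odd p ->
  exists a b : int, (p%:Z %| 1 + a ^+ 2 + b ^+ 2)%Z.
Proof.
move=> pp op; have p1 := prime_gt1 pp.
pose h := p./2; have ph : p = h.*2.+1 by rewrite /h; lia.
pose sq (i : 'I_h.+1) : 'F_p := (i : nat)%:R ^+ 2.
have sq_inj : injective sq.
  move=> i j /eqP; rewrite /sq eqf_sqr => /orP[|/eqP e].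
    rewrite -(inj_eq val_inj) /= !val_Fp_nat //.
    have := ltn_ord i; have := ltn_ord j => hj hi.
    by rewrite !modn_small; [move=> /eqP /val_inj | lia | lia].
  have : ((i + j)%N%:R : 'F_p) == 0 by rewrite natrD e addNr.
  rewrite -(inj_eq val_inj) /= val_Fp_nat // modn_small; last first.
    by have := ltn_ord j; have := ltn_ord i; lia.
  by move=> /eqP ij; apply: val_inj => /=; lia.
pose A := [set sq i | i : 'I_h.+1]; pose B := [set - 1 - sq i | i : 'I_h.+1].
have cA : #|A| = h.+1 by rewrite card_imset // card_ord.
have cB : #|B| = h.+1.
  by rewrite card_imset ?card_ord // => i j /addrI /oppr_inj /sq_inj.
have : A :&: B != set0.
  apply/eqP => AB0; have := cardsUI A B; rewrite AB0 cards0 cA cB addn0 => e.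
  by have := max_card (mem (A :|: B)); rewrite e card_Fp //; lia.
case/set0Pn => _ /setIP[/imsetP[i _ ->] /imsetP[j _ e]].
exists (i : nat), (j : nat).
have : ((1 + (i ^ 2 + j ^ 2))%N%:R : 'F_p) == 0.
  by rewrite !natrD !natrX -/(sq i) e -/(sq j); apply/eqP; ring.
by rewrite -(inj_eq val_inj) /= val_Fp_nat.
Qed.

(** Since [x] has norm [p], the divisibility of [conj(x) q_j] by [p] says that [x] divides [q_j] on
    the left. For odd [p], the descent starts from some [q_i] not divisible by [p] and preserves the
    conditions on the [conj(q_i) q_j]. *)
Lemma quat_prime_divisor (J : finType) (p : nat) (q : J -> quat) : prime p ->
  (forall i j, qdvd p (qmul (qconj (q i)) (q j))) ->
  exists x, qnorm x = p /\ (forall j, qdvd p (qmul (qconj x) (q j))) /\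
    ((forall j, qgauss (q j)) -> (exists j, ~~ qdvd p (q j)) -> qgauss x).
Proof.
move=> pp dq.
have nq i : (p%:Z %| qnorm (q i))%Z.
  have /and4P[h _ _ _] := dq i i; move: h; congr (_ %| _)%Z.
  by rewrite /qnorm /=; ring.
case: (boolP (odd p)) => [op|ep]; last first.
  have {pp ep} p2 : p = 2%N by have := even_prime pp; rewrite (negPf ep); case.
  subst p.
  have par i : (2 %| q0 (q i) + q1 (q i) + q2 (q i) + q3 (q i))%Z.
    have [[ka ea] [kb eb]] := (even_sqr (q0 (q i)), even_sqr (q1 (q i))).
    have [[kc ec] [kd ed]] := (even_sqr (q2 (q i)), even_sqr (q3 (q i))).
    by have := nq i; rewrite /qnorm ea eb ec ed; lia.
  (* [1 + i] is tried first, as it works for every Gaussian family. *)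
  case: (boolP [forall j, qdvd 2 (qmul (qconj (Quat 1 1 0 0)) (q j))]).
    by move=> /forallP h; exists (Quat 1 1 0 0).
  rewrite negb_forall => /existsP[i ni].
  have ab : ~~ (2 %| q0 (q i) - q1 (q i))%Z.
    apply: contra ni => ab; have := par i.
    by rewrite /qdvd /= => h; apply/and4P; split; lia.
  have ng : ~ (forall j, qgauss (q j)).
    by move=> /(_ i) /andP[/eqP c0 /eqP d0]; have := par i; lia.
  have split2 (u : int) : exists v, u = 2 * v \/ u = 2 * v + 1.
    by exists (u %/ 2)%Z; lia.
  case: (boolP (2 %| q0 (q i) - q2 (q i))%Z) => ac.
    exists (Quat 1 0 1 0); split=> //; split=> // j.
    move: (dq i j) (par i) (par j) ab ac.
    case: (q i) (q j) => a b c d [e f g h]; rewrite /qdvd /=.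
    (* Once the parities of the coordinates of [q i] are fixed, the conditions on the products are
       linear modulo 2 in the coordinates of [q j]. *)
    have [a' [->|->]] := split2 a; have [b' [->|->]] := split2 b;
    have [c' [->|->]] := split2 c; have [d' [->|->]] := split2 d;
    move=> h1 h2 h3 h4 h5; lia.
  exists (Quat 1 0 0 1); split=> //; split=> // j.
  move: (dq i j) (par i) (par j) ab ac.
  case: (q i) (q j) => a b c d [e f g h]; rewrite /qdvd /=.
  have [a' [->|->]] := split2 a; have [b' [->|->]] := split2 b;
  have [c' [->|->]] := split2 c; have [d' [->|->]] := split2 d;
  move=> h1 h2 h3 h4 h5; lia.
case: (boolP [forall j, qdvd p (q j)]) => [/forallP dj|].
  (* When [p] divides the whole family any [x] of norm [p] will do; one is obtained from
     [1 + a i + b j]. *)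
  have [a [b ab]] := sum_two_squares_neg1 p pp op.
  have [||x [nx [_ _]]] := qdvd_norm_prime p (Quat 1 a b 0) pp op.
  - by rewrite /qnorm /= expr1n expr0n addr0.
  - by apply/negP => /and4P[]; rewrite /= dvdz1 /=; have := prime_gt1 pp; lia.
  exists x; split=> //; split=> [j|_ [j]]; first exact: qdvd_mull.
  by rewrite dj.
rewrite negb_forall => /existsP[i ni].
have [x [nx [gx dx]]] := qdvd_norm_prime p (q i) pp op (nq i) ni.
exists x; split=> //; split=> [j|gq _]; first exact: dx.
exact: gx.
Qed.

(** * Common left divisors of families *)

Lemma qgaussM (x y : quat) : qgauss x -> qgauss y -> qgauss (qmul x y).
Proof.
move=> /andP[/eqP x2 /eqP x3] /andP[/eqP y2 /eqP y3].
by rewrite /qgauss /= x2 x3 y2 y3; apply/andP; split; apply/eqP; ring.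
Qed.

Lemma qgauss_conj (x : quat) : qgauss x -> qgauss (qconj x).
Proof. by rewrite /qgauss /= !oppr_eq0. Qed.

Lemma qgaussZ (k : int) (x : quat) : k != 0 -> qgauss (qscale k x) = qgauss x.
Proof. by move=> k0; rewrite /qgauss /= !mulf_eq0 (negPf k0). Qed.

(** Take [y_j = conj(x) q_j / qnorm x]. The relation between the products lets an induction continue
    with the family [y]. *)
Lemma quat_family_quotient (J : finType) (x : quat) (q : J -> quat) :
  qnorm x != 0 -> (forall j, qdvd (qnorm x) (qmul (qconj x) (q j))) ->
  exists y : J -> quat, (forall j, q j = qmul x (y j)) /\
    (forall i j, qmul (qconj (q i)) (q j) = qscale (qnorm x) (qmul (qconj (y i)) (y j))) /\
    (qgauss x -> forall j, qgauss (q j) -> qgauss (y j)).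
Proof.
move=> x0 dx; set d := qnorm x in x0 dx *.
pose div1 (v : quat) : quat := Quat (q0 v %/ d)%Z (q1 v %/ d)%Z (q2 v %/ d)%Z (q3 v %/ d)%Z.
have div1K v : qdvd d v -> qscale d (div1 v) = v.
  by case/and4P=> *; apply: quat_eq; rewrite /= mulrC divzK.
pose y j := div1 (qmul (qconj x) (q j)).
have qE j : q j = qmul x (y j).
  by apply: (qscaleI d) => //; rewrite -qscaleAr div1K // qmul_conj.
exists y; split=> //; split=> [i j|gx j gq].
  by rewrite !qE qconjM -qmulA qconj_mul qscaleAr.
by rewrite -(qgaussZ d) // div1K //; apply: qgaussM => //; apply: qgauss_conj.
Qed.

(** One prime factor of [n] at a time: the quotients by a divisor of norm [p] satisfy the hypothesis
    for [n / p]. *)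
Lemma quat_common_divisor (J : finType) (n : nat) (q : J -> quat) : (0 < n)%N ->
  (forall i j, qdvd n (qmul (qconj (q i)) (q j))) ->
  exists x, qnorm x = n /\ forall j, exists y, q j = qmul x y.
Proof.
elim/ltn_ind: n q => n IH q n0 dq.
have [n1|n1] := eqVneq n 1%N.
  exists (Quat 1 0 0 0); rewrite n1; split=> // j; exists (q j).
  by apply: quat_eq => /=; ring.
have pp : prime (pdiv n) by apply: pdiv_prime; lia.
have [m nE] : exists m, n = (pdiv n * m)%N.
  by exists (n %/ pdiv n)%N; rewrite mulnC divnK // pdiv_dvd.
move: (pdiv n) pp nE => p pp nE.
have p1 := prime_gt1 pp; have pz : p%:Z != 0 by lia.
have [|x [nx [dx _]]] := quat_prime_divisor J p q pp.
  move=> i j; have /qdvdP[w ->] := dq i j; apply/qdvdP; exists (qscale m w).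
  by rewrite qscaleA nE PoszM.
rewrite -nx in dx pz; have [y [qE [yy _]]] := quat_family_quotient J x q pz dx.
have [|||w [nw dw]] := IH m _ y; [nia|nia| |].
  move=> i j; have /qdvdP[r er] := dq i j; apply/qdvdP; exists r.
  by apply: (qscaleI _ _ _ pz); rewrite qscaleA nx -PoszM -nE -er yy nx.
exists (qmul x w); split=> [|j]; first by rewrite qnormM nx nw nE PoszM.
by have [z ez] := dw j; exists z; rewrite qE ez qmulA.
Qed.

(** A prime need not be the norm of a Gaussian integer, but [p ^ 2] always is. So each round removes
    a factor of norm [p ^ 2]: either [p] itself, or two successive Gaussian divisors of norm [p]. *)
Lemma gauss_common_divisor (J : finType) (n : nat) (q : J -> quat) : (0 < n)%N ->
  (forall j, qgauss (q j)) ->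
  (forall i j, qdvd (n%:Z ^+ 2) (qmul (qconj (q i)) (q j))) ->
  exists x, qgauss x /\ qnorm x = n%:Z ^+ 2 /\ forall j, exists y, q j = qmul x y.
Proof.
elim/ltn_ind: n q => n IH q n0 gq dq.
have [n1|n1] := eqVneq n 1%N.
  exists (Quat 1 0 0 0); rewrite n1; split=> //; split=> // j; exists (q j).
  by apply: quat_eq => /=; ring.
have pp : prime (pdiv n) by apply: pdiv_prime; lia.
have [m nE] : exists m, n = (pdiv n * m)%N.
  by exists (n %/ pdiv n)%N; rewrite mulnC divnK // pdiv_dvd.
move: (pdiv n) pp nE => p pp nE.
have p1 := prime_gt1 pp; have pz : p%:Z != 0 by lia.
have rec (x : quat) (y : J -> quat) : qgauss x -> qnorm x = p%:Z ^+ 2 ->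
    (forall j, q j = qmul x (y j)) -> (forall j, qgauss (y j)) ->
    exists x, qgauss x /\ qnorm x = n%:Z ^+ 2 /\ forall j, exists y, q j = qmul x y.
  move=> gx nx qE gy.
  have [||||w [gw [nw dw]]] := IH m _ y; [nia|nia|done| |].
    move=> i j; have /qdvdP[r er] := dq i j; apply/qdvdP; exists r.
    apply: (qscaleI (p%:Z ^+ 2)); first by rewrite expf_neq0.
    rewrite qscaleA -exprMn -PoszM -nE -er !qE qconjM -qmulA qconj_mul nx.
    by rewrite qscaleAr.
  exists (qmul x w); split; first exact: qgaussM.
  split=> [|j]; first by rewrite qnormM nx nw nE PoszM exprMn.
  by have [z ez] := dw j; exists z; rewrite qE ez qmulA.
case: (boolP [forall j, qdvd p (q j)]) => [/forallP dj|].
  have np : qnorm (Quat p 0 0 0) = p%:Z ^+ 2 by rewrite /qnorm /=; ring.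
  have [||y [qE [_ gy]]] := quat_family_quotient J (Quat p 0 0 0) q.
  - by rewrite np expf_neq0.
  - move=> j; have /qdvdP[r er] := dj j; apply/qdvdP; exists r.
    by rewrite np er; apply: quat_eq => /=; ring.
  by apply: (rec (Quat p 0 0 0) y) => // j; apply: gy.
rewrite negb_forall => /existsP[k nk].
have [|x [nx [dx gx]]] := quat_prime_divisor J p q pp.
  move=> i j; have /qdvdP[w ->] := dq i j; apply/qdvdP.
  exists (qscale (p%:Z * m%:Z ^+ 2) w).
  by rewrite qscaleA nE PoszM; congr qscale; ring.
have {}gx : qgauss x by apply: gx => //; exists k.
rewrite -nx in dx; have xz : qnorm x != 0 by rewrite nx.
have [y [qE [yy gy]]] := quat_family_quotient J x q xz dx.
have {}gy j : qgauss (y j) by apply: gy.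
(* Dividing by [x] costs one of the two factors [p] of the products; the other one allows a second
   division. *)
have [|x' [nx' [dx' gx']]] := quat_prime_divisor J p y pp.
  move=> i j; have /qdvdP[w ew] := dq i j; apply/qdvdP.
  exists (qscale (m%:Z ^+ 2) w); apply: (qscaleI _ _ _ xz).
  by rewrite -yy ew !qscaleA nE PoszM nx; congr qscale; ring.
have {}gx' : qgauss x'.
  apply: gx' => //; exists k; apply: contra nk => dk.
  by rewrite qE qdvd_mull.
rewrite -nx' in dx'; have xz' : qnorm x' != 0 by rewrite nx'.
have [y' [qE' [_ gy']]] := quat_family_quotient J x' y xz' dx'.
apply: (rec (qmul x x') y').
- exact: qgaussM.
- by rewrite qnormM nx nx' expr2.
- by move=> j; rewrite qE qE' qmulA.
- by move=> j; apply: gy'.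
Qed.

(** * Minors of two orthogonal columns *)

Section ComplementaryMinors.

(** The primed sequences stand for the complex conjugates; as independent variables they make the
    identities below polynomial. *)
Variables (F : numFieldType) (a b a' b' : nat -> F) (lam : F).

Hypothesis aa : a 0 * a' 0 + a 1 * a' 1 + a 2 * a' 2 + a 3 * a' 3 = lam.
Hypothesis bb : b 0 * b' 0 + b 1 * b' 1 + b 2 * b' 2 + b 3 * b' 3 = lam.
Hypothesis ab : a 0 * b' 0 + a 1 * b' 1 + a 2 * b' 2 + a 3 * b' 3 = 0.
Hypothesis ba : b 0 * a' 0 + b 1 * a' 1 + b 2 * a' 2 + b 3 * a' 3 = 0.

Definition minor2 (u v : nat -> F) (i j : nat) : F := u i * v j - v i * u j.

(* The minor on rows [k, l], where [(i, j, k, l)] is an even permutation of [(0, 1, 2, 3)]. *)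
Definition dual_minor2 (u v : nat -> F) (i j : nat) : F :=
  match i, j with
  | 0, 1 => minor2 u v 2 3 | 1, 0 => minor2 u v 3 2
  | 0, 2 => minor2 u v 3 1 | 2, 0 => minor2 u v 1 3
  | 0, 3 => minor2 u v 1 2 | 3, 0 => minor2 u v 2 1
  | 1, 2 => minor2 u v 0 3 | 2, 1 => minor2 u v 3 0
  | 1, 3 => minor2 u v 2 0 | 3, 1 => minor2 u v 0 2
  | 2, 3 => minor2 u v 0 1 | 3, 2 => minor2 u v 1 0
  | _, _ => 0
  end.

(** The entry [P_ij], for [A] with columns [a] and [b]. *)
Definition residual (i j : nat) : F := lam *+ (i == j) - (a i * a' j + b i * b' j).

(** Reduces an equation to a known one, leaving an identity between differences to [ring]. *)
Let eq_of_sub (x y u v : F) : u = v -> x - y = u - v -> x = y.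
Proof. by move=> -> /eqP; rewrite subrr subr_eq0 => /eqP. Qed.

Lemma minor2_gram (i j : nat) :
  minor2 a b i 0 * minor2 a' b' j 0 + minor2 a b i 1 * minor2 a' b' j 1 +
  minor2 a b i 2 * minor2 a' b' j 2 + minor2 a b i 3 * minor2 a' b' j 3 =
  lam * (a i * a' j + b i * b' j).
Proof.
transitivity (a i * a' j * (b 0 * b' 0 + b 1 * b' 1 + b 2 * b' 2 + b 3 * b' 3)
  - a i * b' j * (b 0 * a' 0 + b 1 * a' 1 + b 2 * a' 2 + b 3 * a' 3)
  - b i * a' j * (a 0 * b' 0 + a 1 * b' 1 + a 2 * b' 2 + a 3 * b' 3)
  + b i * b' j * (a 0 * a' 0 + a 1 * a' 1 + a 2 * a' 2 + a 3 * a' 3)).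
  by rewrite /minor2; ring.
by rewrite aa bb ab ba; ring.
Qed.

(** As vectors in their first index, the primed minors lie in the span of [a'] and [b'], on which
    the matrix with entries [a k * a' i + b k * b' i] acts as [lam]. *)
Lemma minor2_transport (i l : nat) :
  (a 0 * a' i + b 0 * b' i) * minor2 a' b' 0 l + (a 1 * a' i + b 1 * b' i) * minor2 a' b' 1 l +
  (a 2 * a' i + b 2 * b' i) * minor2 a' b' 2 l + (a 3 * a' i + b 3 * b' i) * minor2 a' b' 3 l =
  lam * minor2 a' b' i l.
Proof.
transitivity (a' i * b' l * (a 0 * a' 0 + a 1 * a' 1 + a 2 * a' 2 + a 3 * a' 3)
  - a' i * a' l * (a 0 * b' 0 + a 1 * b' 1 + a 2 * b' 2 + a 3 * b' 3)
  + b' i * b' l * (b 0 * a' 0 + b 1 * a' 1 + b 2 * a' 2 + b 3 * a' 3)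
  - b' i * a' l * (b 0 * b' 0 + b 1 * b' 1 + b 2 * b' 2 + b 3 * b' 3)).
  by rewrite /minor2; ring.
by rewrite aa bb ab ba /minor2; ring.
Qed.

(** The component in 1 of [H_i0 H_0j = P_00 H_ij]. For distinct nonzero indices it amounts to an
    entry of [minor2_gram]. *)
Lemma residual_minor (i j : nat) : (i < 4)%N -> (j < 4)%N ->
  residual i 0 * residual 0 j + dual_minor2 a' b' 0 i * dual_minor2 a b 0 j =
  residual 0 0 * residual i j.
Proof.
have K := minor2_gram; have K' k l := esym (K k l).
pose g k := minor2 a b k 0 * minor2 a' b' k 0 + minor2 a b k 1 * minor2 a' b' k 1
  + minor2 a b k 2 * minor2 a' b' k 2 + minor2 a b k 3 * minor2 a' b' k 3.
pose n k := a k * a' k + b k * b' k.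
(* For [i = j > 0], twice the identity is a combination of the trace relation
   [n 0 + n 1 + n 2 + n 3 = 2 lam] and the diagonal entries of [minor2_gram]. *)
have diag (x y : F) (k l m : nat) :
    2 * x - 2 * y =
      lam * (n 0 + n 1 + n 2 + n 3 + n 0 + n k - n l - n m) + g l + g m
      - (2 * lam ^+ 2 + g 0 + g k) -> x = y.
  move=> e; apply: (@mulfI F 2); first by rewrite pnatr_eq0.
  apply: eq_of_sub e.
  have -> : n 0 + n 1 + n 2 + n 3 = lam + lam by rewrite -{1}aa -bb /n; ring.
  by rewrite /g !K /n; ring.
case: i j => [|[|[|[|i]]]] [|[|[|[|j]]]] // _ _; rewrite /residual /= ?mulr1n ?mulr0n;
  first [by rewrite /minor2; ring
        |by apply: (eq_of_sub _ _ _ _ (K' 1%N 2%N)); rewrite /minor2; ring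
        |by apply: (eq_of_sub _ _ _ _ (K' 1%N 3%N)); rewrite /minor2; ring
        |by apply: (eq_of_sub _ _ _ _ (K' 2%N 1%N)); rewrite /minor2; ring
        |by apply: (eq_of_sub _ _ _ _ (K' 2%N 3%N)); rewrite /minor2; ring
        |by apply: (eq_of_sub _ _ _ _ (K' 3%N 1%N)); rewrite /minor2; ring
        |by apply: (eq_of_sub _ _ _ _ (K' 3%N 2%N)); rewrite /minor2; ring
        |idtac].
- by apply: (diag _ _ 1%N 2%N 3%N); rewrite /g /n /minor2; ring.
- by apply: (diag _ _ 2%N 1%N 3%N); rewrite /g /n /minor2; ring.
by apply: (diag _ _ 3%N 1%N 2%N); rewrite /g /n /minor2; ring.
Qed.

(** The component in [j] of the same product formula. *)
Lemma residual_dual (i j : nat) : (i < 4)%N -> (j < 4)%N ->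
  residual i 0 * dual_minor2 a' b' 0 j - dual_minor2 a' b' 0 i * residual j 0 =
  residual 0 0 * dual_minor2 a' b' i j.
Proof.
have T := minor2_transport 0; have T' l := esym (T l).
by case: i j => [|[|[|[|i]]]] [|[|[|[|j]]]] // _ _; rewrite /residual /= ?mulr1n ?mulr0n;
  first [by rewrite /minor2; ring
        |by apply: (eq_of_sub _ _ _ _ (T 1%N)); rewrite /minor2; ring
        |by apply: (eq_of_sub _ _ _ _ (T' 1%N)); rewrite /minor2; ring
        |by apply: (eq_of_sub _ _ _ _ (T 2%N)); rewrite /minor2; ring
        |by apply: (eq_of_sub _ _ _ _ (T' 2%N)); rewrite /minor2; ring
        |by apply: (eq_of_sub _ _ _ _ (T 3%N)); rewrite /minor2; ring
        |by apply: (eq_of_sub _ _ _ _ (T' 3%N)); rewrite /minor2; ring].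
Qed.

End ComplementaryMinors.

(** * Gaussian integers, and quaternions as pairs of them *)

Definition gaussC (a b : int) : algC := a%:~R + 'i * b%:~R.

(* [x] is identified with [cfst x + csnd x * j]. *)
Definition cfst (x : quat) : algC := gaussC (q0 x) (q1 x).
Definition csnd (x : quat) : algC := gaussC (q2 x) (q3 x).

Lemma gaussIntP (u : algC) : reflect (exists a b, u = gaussC a b) (gaussInt u).
Proof.
apply: (iffP andP) => [[/intrP[a ea] /intrP[b eb]]|[a [b ->]]].
  by exists a, b; rewrite /gaussC -ea -eb -Crect.
have ra : (a%:~R : algC) \is Num.real by apply: Rreal_int.
have rb : (b%:~R : algC) \is Num.real by apply: Rreal_int.
by rewrite /gaussC Re_rect // Im_rect // !intr_int.
Qed.

Lemma gaussC_inj (a b c d : int) : gaussC a b = gaussC c d -> a = c /\ b = d.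
Proof.
have r (z : int) : (z%:~R : algC) \is Num.real by apply: Rreal_int.
move=> e; split; apply: (@intr_inj algC).
  by have := congr1 (fun z => 'Re z) e; rewrite /gaussC !Re_rect.
by have := congr1 (fun z => 'Im z) e; rewrite /gaussC !Im_rect.
Qed.

Lemma gaussC_conj (a b : int) : (gaussC a b)^* = gaussC a (- b).
Proof.
rewrite /gaussC rmorphD rmorphM /= conjCi !rmorph_int /= rmorphN /=.
by rewrite mulNr mulrN.
Qed.

Lemma quat_inj (x y : quat) : cfst x = cfst y -> csnd x = csnd y -> x = y.
Proof. by move=> /gaussC_inj[? ?] /gaussC_inj[? ?]; apply: quat_eq. Qed.

(** From [j c = conj(c) j] and [j ^ 2 = -1]. *)
Lemma cfstM (x y : quat) : cfst (qmul x y) = cfst x * cfst y - csnd x * (csnd y)^*.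
Proof.
rewrite /cfst /csnd gaussC_conj /gaussC /= !(rmorphB, rmorphD, rmorphM, rmorphN) /=.
have ii := sqrCi algC; move: ('i) ii => I ii.
set x0 := (q0 x)%:~R; set x1 := (q1 x)%:~R; set x2 := (q2 x)%:~R; set x3 := (q3 x)%:~R.
set y0 := (q0 y)%:~R; set y1 := (q1 y)%:~R; set y2 := (q2 y)%:~R; set y3 := (q3 y)%:~R.
(* [I ^+ 2] is kept where the right-hand product creates it, so that the second [ring] can treat [I]
   as a variable. *)
transitivity (x0 * y0 + I ^+ 2 * x1 * y1 + (- x2 * y2 + I ^+ 2 * x3 * y3)
  + I * (x0 * y1 + x1 * y0 + x2 * y3 - x3 * y2)); first by rewrite ii; ring.
by ring.
Qed.

Lemma csndM (x y : quat) : csnd (qmul x y) = cfst x * csnd y + csnd x * (cfst y)^*.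
Proof.
rewrite /cfst /csnd gaussC_conj /gaussC /= !(rmorphB, rmorphD, rmorphM, rmorphN) /=.
have ii := sqrCi algC; move: ('i) ii => I ii.
set x0 := (q0 x)%:~R; set x1 := (q1 x)%:~R; set x2 := (q2 x)%:~R; set x3 := (q3 x)%:~R.
set y0 := (q0 y)%:~R; set y1 := (q1 y)%:~R; set y2 := (q2 y)%:~R; set y3 := (q3 y)%:~R.
transitivity (x0 * y2 + I ^+ 2 * x1 * y3 + (x2 * y0 - I ^+ 2 * x3 * y1)
  + I * (x0 * y3 + x1 * y2 - x2 * y1 + x3 * y0)); first by rewrite ii; ring.
by ring.
Qed.

Lemma cfst_conj (x : quat) : cfst (qconj x) = (cfst x)^*.
Proof. by rewrite /cfst gaussC_conj. Qed.

Lemma csnd_conj (x : quat) : csnd (qconj x) = - csnd x.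
Proof. by rewrite /csnd /gaussC /= !rmorphN /= opprD mulrN. Qed.

Lemma cfstZ (k : int) (x : quat) : cfst (qscale k x) = k%:~R * cfst x.
Proof. by rewrite /cfst /gaussC /= !rmorphM /=; ring. Qed.

Lemma csndZ (k : int) (x : quat) : csnd (qscale k x) = k%:~R * csnd x.
Proof. by rewrite /csnd /gaussC /= !rmorphM /=; ring. Qed.

Lemma gaussInt_cfst (x : quat) : gaussInt (cfst x).
Proof. by apply/gaussIntP; exists (q0 x), (q1 x). Qed.

Lemma gaussInt_csnd (x : quat) : gaussInt (csnd x).
Proof. by apply/gaussIntP; exists (q2 x), (q3 x). Qed.

(** A sigma type, so that families of quaternions can be defined through [s2val]. *)
Lemma quat_of_pair (u v : algC) : gaussInt u -> gaussInt v ->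
  {x : quat | cfst x = u & csnd x = v}.
Proof.
move=> gu gv; pose f (z : algC) : int := Num.floor z.
have fK (z : algC) : gaussInt z -> gaussC (f ('Re z)) (f ('Im z)) = z.
  by move=> /andP[r i]; rewrite /gaussC /f !floorK // -Crect.
by exists (Quat (f ('Re u)) (f ('Im u)) (f ('Re v)) (f ('Im v))); rewrite /cfst /csnd /= fK.
Qed.

Lemma gaussInt0 : gaussInt 0.
Proof. by apply/gaussIntP; exists 0, 0; rewrite /gaussC; ring. Qed.

Lemma gaussIntD (u v : algC) : gaussInt u -> gaussInt v -> gaussInt (u + v).
Proof.
move=> /gaussIntP[a [b ->]] /gaussIntP[c [d ->]]; apply/gaussIntP.
by exists (a + c), (b + d); rewrite /gaussC !rmorphD /=; ring.
Qed.

Lemma gaussIntN (u : algC) : gaussInt u -> gaussInt (- u).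
Proof.
move=> /gaussIntP[a [b ->]]; apply/gaussIntP.
by exists (- a), (- b); rewrite /gaussC !rmorphN /=; ring.
Qed.

Lemma gaussInt_conj (u : algC) : gaussInt u -> gaussInt u^*.
Proof. by move=> /gaussIntP[a [b ->]]; apply/gaussIntP; exists a, (- b); rewrite gaussC_conj. Qed.

Lemma gaussIntM (u v : algC) : gaussInt u -> gaussInt v -> gaussInt (u * v).
Proof.
move=> gu gv; have [x xu x0] := quat_of_pair u 0 gu gaussInt0.
have [y yv y0] := quat_of_pair v 0 gv gaussInt0.
have := gaussInt_cfst (qmul x y).
by rewrite cfstM xu yv x0 mul0r subr0.
Qed.

Lemma gaussInt_sum (I : finType) (u : I -> algC) :
  (forall i, gaussInt (u i)) -> gaussInt (\sum_i u i).
Proof. by move=> gu; elim/big_ind: _ => //; [exact: gaussInt0 | exact: gaussIntD]. Qed.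

Lemma gaussInt_nat (u : algC) : gaussInt u -> 0 <= u -> exists n : nat, u = n%:R.
Proof.
move=> /andP[iu _] u0; apply/natrP; rewrite natrEint u0 andbT.
by rewrite -(Creal_ReP _ (ger0_real u0)).
Qed.

(** * Conjugate transposes and icubes *)

Lemma ctrmxE m n (A : 'M[algC]_(m, n)) i j : ctrmx A i j = (A j i)^*.
Proof. by rewrite !mxE. Qed.

Lemma ctrmxM m n p (A : 'M[algC]_(m, n)) (B : 'M[algC]_(n, p)) :
  ctrmx (A *m B) = ctrmx B *m ctrmx A.
Proof.
apply/matrixP => i j; rewrite ctrmxE !mxE rmorph_sum /=.
by apply: eq_bigr => k _; rewrite rmorphM /= !ctrmxE mulrC.
Qed.

Lemma ctrmxK m n (A : 'M[algC]_(m, n)) : ctrmx (ctrmx A) = A.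
Proof. by apply/matrixP => i j; rewrite !ctrmxE conjCK. Qed.

Lemma ctrmx_row m n p (A : 'M[algC]_(m, n)) (B : 'M[algC]_(m, p)) :
  ctrmx (row_mx A B) = col_mx (ctrmx A) (ctrmx B).
Proof. by rewrite /ctrmx map_row_mx tr_row_mx. Qed.

Lemma mul_ctrmxE m n (A : 'M[algC]_(m, n)) i j :
  (A *m ctrmx A) i j = \sum_k A i k * (A j k)^*.
Proof. by rewrite mxE; apply: eq_bigr => k _; rewrite ctrmxE. Qed.

Lemma icubeP n k (A : 'M[algC]_(n, k)) lam :
  icube A lam <->
  [/\ 0 < lam, forall i j, gaussInt (A i j) & ctrmx A *m A = lam%:M].
Proof.
split=> [[l0 [gA cA]]|[l0 gA cA]].
  by split=> //; apply/matrixP => i j; rewrite cA mxE; case: eqP.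
by split=> //; split=> // i j; rewrite cA mxE; case: eqP.
Qed.

(** Up to the factor [lam], a right inverse of a square matrix is a left inverse. *)
Lemma ctrmx_mulC n (M : 'M[algC]_n) lam : lam != 0 ->
  M *m ctrmx M = lam%:M -> ctrmx M *m M = lam%:M.
Proof.
move=> l0 e; have : (lam^-1 *: M) *m ctrmx M = 1%:M.
  by rewrite -scalemxAl e scale_scalar_mx mulVf.
move=> /mulmx1C; rewrite -scalemxAr => /(congr1 (fun X => lam *: X)).
by rewrite scalerA mulfV // scale1r scale_scalar_mx mulr1.
Qed.

(** The equation says that the square matrix [(A | B)] has orthogonal rows of norm [lam]; hence so
    are its columns. *)
Lemma icube_complete m n (A : 'M[algC]_(m + n, m)) (B : 'M[algC]_(m + n, n)) lam :
  icube A lam -> (forall i j, gaussInt (B i j)) ->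
  A *m ctrmx A + B *m ctrmx B = lam%:M -> icube_extends A (m + n) lam.
Proof.
move=> /icubeP[l0 gA cA] gB e; exists (row_mx A B), (lshift n).
split; last first.
  split=> [|j]; first exact: lshift_inj.
  by apply/colP => i; rewrite mxE row_mxEl mxE.
apply/icubeP; split=> // [i j|]; first by rewrite mxE; case: split.
by apply: ctrmx_mulC; rewrite ?gt_eqF // ctrmx_row mul_row_col.
Qed.

(** [lam] is a diagonal entry of [A' A], hence a Gaussian integer; [k.+1] provides a column. *)
Lemma icube_norm_nat n k (A : 'M[algC]_(n, k.+1)) lam : icube A lam ->
  exists2 l : nat, (0 < l)%N & lam = l%:R.
Proof.
move=> [l0 [gA /(_ ord0 ord0)]]; rewrite eqxx => e.
have [||l el] := gaussInt_nat lam; last by exists l; rewrite // -(ltr0n algC) -el.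
  rewrite -e mxE; apply: gaussInt_sum => i; apply: gaussIntM => //.
  by rewrite ctrmxE; apply: gaussInt_conj.
exact: ltW.
Qed.

Lemma gaussInt_mul_ctrmx n k (A : 'M[algC]_(n, k)) i j :
  (forall i j, gaussInt (A i j)) -> gaussInt ((A *m ctrmx A) i j).
Proof.
move=> gA; rewrite mul_ctrmxE; apply: gaussInt_sum => r.
by apply: gaussIntM => //; apply: gaussInt_conj.
Qed.

Lemma gaussInt_scalar n (u : algC) (i j : 'I_n) : gaussInt u -> gaussInt (u%:M i j).
Proof. by move=> gu; rewrite mxE; case: eqP => _ //=; apply: gaussInt0. Qed.

(** * Completing two columns *)

Lemma sum4 (u : 'I_4 -> algC) :
  \sum_i u i = u (inord 0) + u (inord 1) + u (inord 2) + u (inord 3).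
Proof.
rewrite !big_ord_recl big_ord0 addr0 !addrA.
by congr (u _ + u _ + u _ + u _); apply: val_inj; rewrite /= inordK.
Qed.

Lemma sum2 (u : 'I_2 -> algC) : \sum_i u i = u 0 + u 1.
Proof.
rewrite !big_ord_recl big_ord0 addr0.
by congr (u _ + u _); apply: val_inj.
Qed.

Lemma conj_minor2 (u v : nat -> algC) i j :
  (minor2 _ u v i j)^* = minor2 _ (fun k => (u k)^*) (fun k => (v k)^*) i j.
Proof. by rewrite /minor2 rmorphB !rmorphM. Qed.

Lemma conj_dual_minor2 (u v : nat -> algC) i j :
  (dual_minor2 _ u v i j)^* = dual_minor2 _ (fun k => (u k)^*) (fun k => (v k)^*) i j.
Proof.
by case: i j => [|[|[|[|i]]]] [|[|[|[|j]]]]; rewrite /dual_minor2 ?conj_minor2 ?conjC0.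
Qed.

Lemma gaussInt_dual_minor2 (u v : nat -> algC) i j :
  (forall k, gaussInt (u k)) -> (forall k, gaussInt (v k)) ->
  gaussInt (dual_minor2 _ u v i j).
Proof.
move=> gu gv.
have gm k l : gaussInt (minor2 _ u v k l).
  by rewrite /minor2; apply: gaussIntD; [|apply: gaussIntN]; apply: gaussIntM.
by case: i j => [|[|[|[|i]]]] [|[|[|[|j]]]]; rewrite /dual_minor2 //; apply: gaussInt0.
Qed.

(** Here [P_00] is nonzero, so dividing the [H_0j] by their common divisor of norm [P_00] gives
    [y_j] with [conj(y_i) y_j = H_ij], whose component in 1 is [P_ij]. *)
Lemma icube2_residual0 (A : 'M[algC]_(4, 2)) lam : icube A lam ->
  lam - (A *m ctrmx A) 0 0 != 0 ->
  exists2 B : 'M[algC]_(4, 2), forall i j, gaussInt (B i j) &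
    A *m ctrmx A + B *m ctrmx B = lam%:M.
Proof.
move=> cA nz; have [l l0 lE] := icube_norm_nat _ _ _ _ cA.
have /icubeP[lam0 gA AA] := cA.
have glam : gaussInt lam.
  by rewrite lE; apply/gaussIntP; exists l, 0; rewrite /gaussC pmulrn; ring.
pose Q := lam%:M - A *m ctrmx A.
have gQ i j : gaussInt (Q i j).
  rewrite !mxE -[X in _ - X]/((\sum_k _)); apply: gaussIntD.
    by have := gaussInt_scalar _ lam i j glam; rewrite mxE.
  by apply: gaussIntN; have := gaussInt_mul_ctrmx _ _ A i j gA; rewrite mxE.
have Qherm i j : (Q i j)^* = Q j i.
  have cl : lam^* = lam by rewrite lE conjC_nat.
  rewrite /Q mxE mxE mxE mul_ctrmxE [in RHS]mxE [in RHS]mxE [in RHS]mxE mul_ctrmxE.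
  rewrite rmorphB /= rmorphMn /= cl eq_sym rmorph_sum /=; congr (_ - _).
  by apply: eq_bigr => k _; rewrite rmorphM /= conjCK mulrC.
have AQ : ctrmx A *m Q = 0.
  by rewrite /Q mulmxBr mulmxA AA mul_scalar_mx mul_mx_scalar subrr.
have QQ : Q *m Q = lam *: Q.
  by rewrite {1}/Q mulmxBl -mulmxA AQ mulmx0 subr0 mul_scalar_mx.
have Q00 : Q 0 0 = lam - (A *m ctrmx A) 0 0 by rewrite !mxE mulr1n.
(* As [Q] is hermitian and [Q Q = lam Q], the product [lam * Q 0 0] is a sum of squared absolute
   values. *)
have Q00ge : 0 <= Q 0 0.
  rewrite -(pmulr_rge0 _ lam0); have -> : lam * Q 0 0 = (Q *m Q) 0 0 by rewrite QQ [RHS]mxE.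
  rewrite mxE sumr_ge0 // => k _; rewrite -(Qherm 0 k); exact: mul_conjC_ge0.
have [n nE] := gaussInt_nat _ (gQ 0 0) Q00ge.
have n0 : (0 < n)%N.
  by rewrite lt0n; apply: contra nz => /eqP nz; rewrite -Q00 nE nz.
pose a k := A (inord k) 0; pose b k := A (inord k) 1.
pose a' k := (a k)^*; pose b' k := (b k)^*.
have ortho i j : A (inord 0) j * (A (inord 0) i)^* + A (inord 1) j * (A (inord 1) i)^*
   + A (inord 2) j * (A (inord 2) i)^* + A (inord 3) j * (A (inord 3) i)^* = lam *+ (i == j).
  have := congr1 (fun M : 'M[algC]_2 => M i j) AA; rewrite mxE sum4 !ctrmxE [RHS]mxE => <-.
  by ring.
have aa := ortho 0 0; have bb := ortho 1 1; have ab := ortho 1 0; have ba := ortho 0 1.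
rewrite /= ?mulr1n ?mulr0n in aa bb ab ba.
have resE (i j : 'I_4) : residual _ a b a' b' lam i j = Q i j.
  rewrite /residual /Q !mxE sum2 !ctrmxE /a' /b' /a /b !inord_val.
  by rewrite (inj_eq val_inj).
pose dl i j := dual_minor2 _ a' b' i j.
have gdl i j : gaussInt (dl i j).
  by apply: gaussInt_dual_minor2 => k; apply: gaussInt_conj; apply: gA.
have dlC i j : (dl i j)^* = dual_minor2 _ a b i j.
  by rewrite conj_dual_minor2 /a' /b' /dual_minor2 /minor2 !conjCK.
pose q (j : 'I_4) := s2val (quat_of_pair _ _ (gQ 0 j) (gdl 0 j)).
have qf j : cfst (q j) = Q 0 j by rewrite /q; case: quat_of_pair.
have qs j : csnd (q j) = dl 0%N j by rewrite /q; case: quat_of_pair.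
pose H (i j : 'I_4) := s2val (quat_of_pair _ _ (gQ i j) (gdl i j)).
have Hf i j : cfst (H i j) = Q i j by rewrite /H; case: quat_of_pair.
have Hs i j : csnd (H i j) = dl i j by rewrite /H; case: quat_of_pair.
have qq i j : qmul (qconj (q i)) (q j) = qscale n (H i j).
  apply: quat_inj.
    rewrite cfstM cfstZ cfst_conj csnd_conj !qf !qs Hf dlC Qherm -pmulrn -nE mulNr opprK.
    rewrite -!resE; exact: residual_minor.
  rewrite csndM csndZ cfst_conj csnd_conj !qf !qs Hs !Qherm -pmulrn -nE mulNr.
  rewrite -!resE; exact: residual_dual.
have [|x [nx dx]] := quat_common_divisor _ n q n0.
  by move=> i j; apply/qdvdP; exists (H i j).
have nz' : qnorm x != 0 by rewrite nx; lia.
have [|y [qE [yy _]]] := quat_family_quotient _ x q nz'.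
  by move=> j; have [z ->] := dx j; apply/qdvdP; exists z; rewrite qconj_mul.
have yH i j : qmul (qconj (y i)) (y j) = H i j.
  by apply: (qscaleI _ _ _ nz'); rewrite -yy qq nx.
exists (\matrix_(i, j) if j == 0 then cfst (qconj (y i)) else csnd (qconj (y i))).
  move=> i j; rewrite mxE; case: eqP => _; [exact: gaussInt_cfst | exact: gaussInt_csnd].
apply/matrixP => i j; have <- : A *m ctrmx A + Q = lam%:M by rewrite addrC subrK.
rewrite [LHS]mxE [RHS]mxE; congr (_ + _).
rewrite -Hf -yH mul_ctrmxE sum2 !mxE /= cfstM !cfst_conj !csnd_conj conjCK.
by rewrite rmorphN mulrN mulNr opprK.
Qed.

Lemma mul_ctrmx_row_perm n k (s : 'S_n) (A : 'M[algC]_(n, k)) i j :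
  (row_perm s A *m ctrmx (row_perm s A)) i j = (A *m ctrmx A) (s i) (s j).
Proof. by rewrite !mul_ctrmxE; apply: eq_bigr => r _; rewrite !mxE. Qed.

Lemma icube_row_perm n k (s : 'S_n) (A : 'M[algC]_(n, k)) lam :
  icube A lam -> icube (row_perm s A) lam.
Proof.
move=> [l0 [gA cA]]; split=> //; split=> [i j|i j]; first by rewrite mxE.
rewrite -cA [LHS]mxE [RHS]mxE [RHS](reindex_inj (@perm_inj _ s)).
by apply: eq_bigr => r _; rewrite !mxE.
Qed.

(** [A A'] has the trace [2 lam] of [A' A], so its diagonal entries are not all [lam]; a
    transposition of rows brings a nonzero [P_rr] to position 0. *)
Lemma icube2_residual (A : 'M[algC]_(4, 2)) lam : icube A lam ->
  exists2 B : 'M[algC]_(4, 2), forall i j, gaussInt (B i j) &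
    A *m ctrmx A + B *m ctrmx B = lam%:M.
Proof.
move=> cA; have /icubeP[l0 gA AA] := cA.
have [r nzr] : exists r, lam - (A *m ctrmx A) r r != 0.
  apply/existsP; rewrite -negb_forall; apply/negP => /forallP h.
  have : \tr (A *m ctrmx A) = lam *+ 4.
    rewrite /mxtrace (eq_bigr (fun=> lam)) ?sumr_const ?card_ord // => i _.
    by have := h i; rewrite subr_eq0 => /eqP ->.
  rewrite mxtrace_mulC AA mxtrace_scalar => /esym /eqP.
  by rewrite -subr_eq0 -mulrnBr // mulrn_eq0 /= (gt_eqF l0).
pose s := tperm 0 r.
have [|B' gB' e] := icube2_residual0 (row_perm s A) lam (icube_row_perm _ _ s A lam cA).
  by rewrite mul_ctrmx_row_perm tpermL.
exists (row_perm s B') => [i j|]; first by rewrite mxE.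
apply/matrixP => i j.
have := congr1 (fun M : 'M[algC]_4 => M (s i) (s j)) e.
rewrite mxE mul_ctrmx_row_perm !tpermK [X in _ + X = _]mxE => e'.
rewrite mxE mul_ctrmx_row_perm [X in _ + X]mxE e' !mxE.
by rewrite (inj_eq perm_inj).
Qed.

(** * Completing three columns *)

Lemma icube3_residual (A : 'M[algC]_(4, 3)) lam : icube A lam ->
  exists2 z : 'cV[algC]_4, forall i j, gaussInt (z i j) &
    A *m ctrmx A + z *m ctrmx z = lam%:M.
Proof.
move=> cA; have [l lpos lE] := icube_norm_nat _ _ _ _ cA.
have /icubeP[l0 gA AA] := cA.
pose A2 : 'M[algC]_(4, 2) := @lsubmx _ 4 2 1 A.
pose v : 'cV[algC]_4 := @rsubmx _ 4 2 1 A.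
have AE : A = @row_mx _ 4 2 1 A2 v by rewrite hsubmxK.
have : ctrmx (@row_mx _ 4 2 1 A2 v) *m (@row_mx _ 4 2 1 A2 v) = lam%:M by rewrite -AE.
rewrite ctrmx_row mul_col_row (scalar_mx_block 2 1) => /eq_block_mx[A2A2 A2v _ vv].
have AAE : A *m ctrmx A = A2 *m ctrmx A2 + v *m ctrmx v.
  by rewrite -mul_row_col -ctrmx_row -AE.
have cA2 : icube A2 lam by apply/icubeP; split=> // i j; rewrite mxE.
have [B gB AB] := icube2_residual A2 lam cA2.
have gv i j : gaussInt (v i j) by rewrite mxE.
pose e : 'cV[algC]_2 := ctrmx B *m v.
(* [B B' = lam I - A2 A2'], and [v] is orthogonal to the columns of [A2]. *)
have Be : B *m e = lam *: v.
  have := congr1 (fun M => M *m v) AB.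
  by rewrite mulmxDl -!mulmxA A2v mulmx0 add0r mul_scalar_mx.
have ee : ctrmx e *m e = (lam ^+ 2)%:M.
  by rewrite {1}/e ctrmxM ctrmxK -mulmxA Be -scalemxAr vv scale_scalar_mx expr2.
have ge i : gaussInt (e i 0).
  rewrite mxE; apply: gaussInt_sum => k; apply: gaussIntM => //.
  by rewrite ctrmxE; apply: gaussInt_conj.
(* A vector orthogonal to [e] of the same norm, so the rank-one matrices of [e] and [e'] add up to
   [lam ^ 2] times the identity. *)
pose e' : 'cV[algC]_2 := \col_i (if i == 0 then - (e 1 0)^* else (e 0 0)^*).
have eN : e 0 0 * (e 0 0)^* + e 1 0 * (e 1 0)^* = lam ^+ 2.
  have := congr1 (fun M : 'M[algC]_1 => M 0 0) ee.
  rewrite mxE sum2 !ctrmxE [RHS]mxE mulr1n => <-; ring.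
have ee' : e' *m ctrmx e' = (lam ^+ 2)%:M - e *m ctrmx e.
  apply/matrixP => i j; rewrite mul_ctrmxE big_ord1 [RHS]mxE [X in _ + X]mxE.
  rewrite mul_ctrmxE big_ord1 [X in _ = X - _]mxE -eN !mxE.
  have two (r : 'I_2) : r = 0 \/ r = 1.
    by case: r => [[|[|]]] // h; [left|right]; apply: val_inj.
  by case: (two i) (two j) => -> [] -> /=; rewrite ?mulr1n ?mulr0n ?rmorphN /= ?conjCK; ring.
pose w : 'cV[algC]_4 := B *m e'.
have ww : w *m ctrmx w = lam ^+ 2 *: (lam%:M - A *m ctrmx A).
  rewrite /w ctrmxM mulmxA -(mulmxA B) ee' mulmxBr mulmxBl mul_mx_scalar -scalemxAl.
  rewrite (mulmxA B e) -(mulmxA _ (ctrmx e)) -ctrmxM Be.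
  have -> : ctrmx (lam *: v) = lam *: ctrmx v.
    apply/matrixP => i j; rewrite ctrmxE !mxE rmorphM /=.
    by rewrite lE conjC_nat.
  rewrite -scalemxAl -scalemxAr scalerA -expr2 -scalerBr; congr (_ *: _).
  by rewrite -AB AAE opprD addrA [_ + B *m _]addrC addrK.
have gw i : gaussInt (w i 0).
  rewrite mxE; apply: gaussInt_sum => k; apply: gaussIntM => //.
  rewrite mxE; case: eqP => _; last exact: gaussInt_conj.
  by apply: gaussIntN; apply: gaussInt_conj.
have wwE i j : w i 0 * (w j 0)^* = lam ^+ 2 * (lam%:M - A *m ctrmx A) i j.
  have := congr1 (fun M : 'M[algC]_4 => M i j) ww.
  by rewrite mul_ctrmxE big_ord1 [RHS]mxE.
have glam : gaussInt lam.
  by rewrite lE; apply/gaussIntP; exists l, 0; rewrite /gaussC pmulrn; ring.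
have gQ i j : gaussInt ((lam%:M - A *m ctrmx A) i j).
  rewrite mxE; apply: gaussIntD; first exact: gaussInt_scalar.
  by rewrite mxE; apply: gaussIntN; apply: gaussInt_mul_ctrmx.
pose q (j : 'I_4) := s2val (quat_of_pair _ _ (gw j) gaussInt0).
have qf j : cfst (q j) = w j 0 by rewrite /q; case: quat_of_pair.
have qs j : csnd (q j) = 0 by rewrite /q; case: quat_of_pair.
have gaussE x : qgauss x <-> csnd x = 0.
  split=> [/andP[/eqP x2 /eqP x3]|]; first by rewrite /csnd x2 x3 /gaussC; ring.
  have -> : 0 = gaussC 0 0 by rewrite /gaussC; ring.
  by move=> /gaussC_inj[x2 x3]; rewrite /qgauss x2 x3 !eqxx.
have lamZ : ((l%:Z ^+ 2)%:~R : algC) = lam ^+ 2 by rewrite rmorphXn /= -pmulrn lE.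
have [||x [gx [nx dx]]] := gauss_common_divisor _ l q lpos.
- by move=> j; apply/gaussE.
- move=> i j; have [r rf rs] := quat_of_pair _ _ (gQ j i) gaussInt0.
  apply/qdvdP; exists r; apply: quat_inj.
    rewrite cfstM cfst_conj csnd_conj cfstZ !qf !qs rf lamZ.
    by rewrite oppr0 mul0r subr0 mulrC wwE.
  by rewrite csndM csndZ csnd_conj !qs rs oppr0 mul0r !mulr0 addr0.
have nz : qnorm x != 0 by rewrite nx expf_neq0 //; lia.
have [|y [qE [yy gy]]] := quat_family_quotient _ x q nz.
  by move=> j; have [z ->] := dx j; apply/qdvdP; exists z; rewrite qconj_mul.
have ys j : csnd (y j) = 0 by apply/gaussE; apply: gy => //; apply/gaussE.
exists (\col_i cfst (y i)) => [i j|]; first by rewrite mxE gaussInt_cfst.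
have <- : A *m ctrmx A + (lam%:M - A *m ctrmx A) = lam%:M by rewrite addrC subrK.
congr (_ + _); apply/matrixP => i j.
rewrite mul_ctrmxE big_ord1 ![(\col_i _) _ _]mxE.
(* The factor [lam ^ 2] of [w w'] cancels against the norm of the common divisor [x]. *)
apply: (mulfI (expf_neq0 2 (lt0r_neq0 l0))); rewrite -wwE -!qf.
have := congr1 cfst (yy j i).
rewrite cfstZ nx lamZ !cfstM !cfst_conj !csnd_conj !qs !ys oppr0 !mul0r !subr0 => e2.
by rewrite [RHS]mulrC e2; congr (_ * _); exact: mulrC.
Qed.

(** * One column, and the theorem *)

Lemma icube1_extends (A : 'M[algC]_(4, 1)) lam : icube A lam -> icube_extends A 2 lam.
Proof.
move=> /icubeP[l0 gA AA].
pose a k := A (inord k) 0.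
have aN : (a 0%N)^* * a 0%N + (a 1%N)^* * a 1%N + (a 2)^* * a 2 + (a 3)^* * a 3 = lam.
  have := congr1 (fun M : 'M[algC]_1 => M 0 0) AA.
  by rewrite mxE sum4 !ctrmxE [RHS]mxE mulr1n.
pose w (i : 'I_4) : algC := nth 0 [:: - (a 1%N)^*; (a 0%N)^*; - (a 3)^*; (a 2)^*] i.
have gw i : gaussInt (w i).
  have gc k : gaussInt (a k)^* by apply: gaussInt_conj; apply: gA.
  by case: i => [[|[|[|[|i]]]]] // hi; rewrite /w /= ?gaussIntN.
have wE k : (k < 4)%N -> w (inord k) = nth 0 [:: - (a 1%N)^*; (a 0%N)^*; - (a 3)^*; (a 2)^*] k.
  by move=> hk; rewrite /w inordK.
exists (\matrix_(i, j) if j == 0 :> 'I_2 then A i 0 else w i), (fun=> 0).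
split; last first.
  split=> [i j _|j]; first by rewrite !ord1.
  by apply/colP => i; rewrite !mxE ord1.
split=> //; split=> [i j|i j]; first by rewrite mxE; case: eqP.
rewrite mxE sum4 !ctrmxE !mxE.
have two (r : 'I_2) : r = 0 \/ r = 1.
  by case: r => [[|[|]]] // h; [left|right]; apply: val_inj.
by case: (two i) (two j) => -> [] -> /=; rewrite ?wE //= ?rmorphN /= ?conjCK
  -/(a 0%N) -/(a 1%N) -/(a 2) -/(a 3) -?aN; ring.
Qed.

Theorem mainTheorem5 :
  forall (k : nat), (1 <= k <= 4)%N ->
  forall (A : 'M[algC]_(4, k)) (lam : algC),
    icube A lam -> icube_extends A 4 lam.
Proof.
have ext2 (A : 'M[algC]_(4, 2)) lam : icube A lam -> icube_extends A 4 lam.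
  move=> cA; have [B gB AB] := icube2_residual A lam cA.
  exact: (icube_complete 2 2 A B).
(* Here [//] also settles two columns, by [ext2]; a single column is first extended to two. *)
case=> [|[|[|[|[|k]]]]] // _ A lam cA.
- have [B [f [cB [fI fE]]]] := icube1_extends A lam cA.
  have [C [g [cC [gI gE]]]] := ext2 B lam cB.
  exists C, (g \o f); split=> //; split=> [|j]; first exact: inj_comp.
  by rewrite /= gE fE.
- have [z gz Az] := icube3_residual A lam cA.
  exact: (icube_complete 3 1 A z).
by exists A, id; split=> //; split.
Qed.
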